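(* Let $d$ and $m$ be integers with $1\le m<d$. For each $n\in\mathbb{Z}_+$, $1\le k\le m$ and $1\le i\le d$, let $b_{n,k,i}\in\mathbb{Z}$, and suppose that $|b_{n,k,i}|$ is bounded by a polynomial in $n$ (that is, there is a polynomial $f$ with $|b_{n,k,i}|\le f(n)$ for all $n,k,i$). For a given $n$, choose integers $s_{ki}$ ($1\le k\le m$, $1\le i\le d$) independently, with $s_{ki}$ uniformly distributed on the set of integers satisfying $b_{n,k,i}\le s_{ki}<b_{n,k,i}+n$. Let $s_k=(s_{k1},\ldots,s_{kd})\in\mathbb{Z}^d$ and let $S=\{s_1,s_2,\ldots,s_m\}$. Then, as $n\to\infty$, the probability that $S$ is a primitive set approaches \[\frac{1}{\zeta(d)\zeta(d-1)\cdots\zeta(d-m+1)},\] where $\zeta(a)=\sum_{i=1}^{\infty}\frac{1}{i^a}$ is the Riemann zeta function.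
   Context: $\mathbb{Z}_+$ denotes the positive integers. A set $S=\{s_1,\ldots,s_m\}\subset\mathbb{Z}^d$, where $1\le m\le d$, is called primitive if $S$ is a $\mathbb{Z}$-basis for the lattice $\operatorname{span}_{\mathbb{R}}(S)\cap\mathbb{Z}^d$. Here $S$ is understood as the list $s_1,\ldots,s_m$, so primitivity requires $s_1,\ldots,s_m$ to be linearly independent and to form a $\mathbb{Z}$-basis of $\operatorname{span}_{\mathbb{R}}(s_1,\ldots,s_m)\cap\mathbb{Z}^d$. *)

(* Defs.v *)
From HB Require Import structures.
From mathcomp Require Import all_boot all_order all_algebra.
From mathcomp Require Import all_classical all_reals all_analysis.

Set Implicit Arguments.
Unset Strict Implicit.
Unset Printing Implicit Defensive.

Import Order.TTheory GRing.Theory Num.Theory.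
Import numFieldNormedType.Exports.

Local Open Scope classical_set_scope.
Local Open Scope ring_scope.

HB.instance Definition _ := isPointed.Build int 0.

HB.instance Definition _ := @isMeasurable.Build default_measure_display
  int discrete_measurable discrete_measurable0
  discrete_measurableC discrete_measurableU.

(* A list of m vectors of Z^d is encoded as the m x d integer matrix whose
   k-th row is the k-th vector. *)
Definition span_lattice (R : realType) (m d : nat) (S : 'M[int]_(m, d)) :
    set 'rV[int]_d :=
  [set v | (map_mx (intr : int -> R) v <= map_mx (intr : int -> R) S)%MS].

Definition is_Zbasis (m d : nat) (S : 'M[int]_(m, d)) (L : set 'rV[int]_d) :
    Prop :=
  (forall k : 'I_m, L (row k S)) /\
  (forall v : 'rV[int]_d, L v ->
    exists! c : {ffun 'I_m -> int}, v = \sum_(k < m) c k *: row k S).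

Definition primitive (R : realType) (m d : nat) (S : 'M[int]_(m, d)) : Prop :=
  row_free (map_mx (intr : int -> R) S) /\
  is_Zbasis S (span_lattice R S).

Definition mutually_independent (d d' : measure_display)
    (T : measurableType d) (T' : measurableType d') (R : realType)
    (P : probability T R) (I : finType) (X : I -> {RV P >-> T'}) : Prop :=
  forall (J : {set I}) (B : I -> set T'),
    (forall i, measurable (B i)) ->
    P (\bigcap_(i in [set` J]) (X i @^-1` B i)) =
      (\prod_(i in J) P (X i @^-1` B i))%E.

(* Uniform distribution on the n integers a with b <= a < b + n (for n > 0). *)
Definition uniform_int (d : measure_display) (T : measurableType d)
    (R : realType) (P : probability T R) (X : {RV P >-> int})
    (b : int) (n : nat) : Prop :=
  forall a : int,
    distribution P X [set a] =
      (if (b <= a) && (a < b + n%:Z) then n%:R^-1 else 0)%:E.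

(* [riemannR a i] is [1 / (i + 1) `^ a], so the sum starts at 1 / 1 `^ a. *)
Definition zeta (R : realType) (a : R) : R := limn (series (riemannR a)).

(* Main.v *)
(* The set S is primitive iff its matrix has rank m modulo every prime p, by the
   Smith normal form.  For the primes p <= M this is a periodic condition, so by
   the Chinese remainder theorem and the count of full-rank matrices over F_p
   its probability tends to the product over p <= M and j < m of
   1 - p^-(d-j), which tends to the claimed limit as M grows (Euler product).

   The larger primes contribute little.  For M < p <= n, a row is a combination
   of the others modulo p with probability O(p^(m-1) (2/p)^d) = O(1/p^2), and
   these bounds add up to O(1/M).  For p > n, let D_r be the leading r x r minor.
   Since D_(r+1) is affine in its last entry with slope D_r, all D_r are nonzero
   outside probability O(1/n).  The entries are polynomial in n, so D_(r+1) <> 0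
   has only boundedly many prime factors p > n; if the leading r x (r+1) block
   has rank r modulo such a p, at most one value of the entry (r, r+1)
   (counted from 0) makes the leading (r+1) x (r+2) block rank-deficient
   modulo p, an event of probability at most 1/n. *)

Require Import Defs.
From HB Require Import structures.
From mathcomp Require Import all_boot all_order all_algebra.
From mathcomp Require Import all_classical all_reals all_analysis.
From mathcomp Require Import perm zify ring lra.

Set Implicit Arguments.
Unset Strict Implicit.
Unset Printing Implicit Defensive.

Import Order.TTheory GRing.Theory Num.Theory.
Import numFieldNormedType.Exports.

Local Open Scope classical_set_scope.
Local Open Scope ring_scope.

(** * Frequencies over a box of side n *)

Section BoxFrequency.
Variables (R : realType) (I : finType).
Implicit Types (b u v : I -> int) (X Y : pred (I -> int)).

(** Points are plain functions, so that one predicate can be measured over boxes of any corner and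
    side; only the offsets form a finite type. *)
Definition box_point b n (x : {ffun I -> 'I_n}) : I -> int :=
  fun i => b i + (x i)%:Z.

Definition in_box b n u := forall i, b i <= u i < b i + n%:Z.

Definition box_freq b n X : R :=
  #|[pred x : {ffun I -> 'I_n} | X (box_point b x)]|%:R / (n ^ #|I|)%:R.

Lemma box_point_in b n (x : {ffun I -> 'I_n}) : in_box b n (box_point b x).
Proof. by move=> i; rewrite /box_point; have := ltn_ord (x i); lia. Qed.

Lemma box_freq_le b n X Y :
  (forall u, in_box b n u -> X u -> Y u) -> box_freq b n X <= box_freq b n Y.
Proof.
move=> XY; rewrite ler_wpM2r ?invr_ge0// ler_nat; apply: subset_leq_card.
by apply/fintype.subsetP => x; rewrite !inE; apply: XY; exact: box_point_in.
Qed.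

Lemma box_freq0 b n : box_freq b n pred0 = 0.
Proof. by rewrite /box_freq (eq_card0 (A := _)) ?mul0r// => x; rewrite inE. Qed.

Lemma box_freqT b n : (0 < n)%N -> box_freq b n predT = 1.
Proof.
move=> n0; rewrite /box_freq (eq_card (B := predT)); last first.
  by move=> x; rewrite !inE.
by rewrite card_ffun card_ord divff// pnatr_eq0 expn_eq0; lia.
Qed.

Lemma box_freqU b n X Y :
  box_freq b n [pred u | X u || Y u] <= box_freq b n X + box_freq b n Y.
Proof.
rewrite -mulrDl ler_wpM2r ?invr_ge0// -natrD ler_nat.
rewrite -cardUI; apply: leq_trans (leq_addr _ _).
by apply: subset_leq_card; apply/fintype.subsetP => x; rewrite !inE.
Qed.

Lemma box_freq_has b n (C : Type) (s : seq C) (X : C -> pred (I -> int)) :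
  box_freq b n [pred u | has (X^~ u) s] <= \sum_(c <- s) box_freq b n (X c).
Proof.
elim: s => [|c s IH]; first by rewrite big_nil box_freq0.
rewrite big_cons; apply: le_trans (box_freqU b n (X c) _) _.
by rewrite lerD2l.
Qed.

Lemma box_freq_exists b n (C : finType) (A : pred C) (X : C -> pred (I -> int)) :
  box_freq b n [pred u | [exists c in A, X c u]] <=
    \sum_(c in A) box_freq b n (X c).
Proof.
rewrite -big_enum; apply: le_trans (box_freq_has _ _ _ _).
apply: box_freq_le => u _ /existsP[c /andP[Ac Xu]].
by apply/hasP; exists c; rewrite // mem_enum.
Qed.

Lemma box_freq_forall b n (F : I -> pred int) :
  box_freq b n [pred u | [forall i, F i (u i)]] =
    \prod_i (#|[pred t : 'I_n | F i (b i + t%:Z)]|%:R / n%:R).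
Proof.
rewrite /box_freq big_split /= prodr_const natrX exprVn; congr (_ / _).
rewrite -natr_prod; congr (_%:R).
rewrite (eq_card (B := family (fun i => [pred t : 'I_n | F i (b i + t%:Z)]))).
  by rewrite card_family foldrE big_map big_enum.
by move=> x; rewrite !inE; apply: eq_forallb.
Qed.

Definition mix (J : pred I) u v : I -> int := fun i => if J i then v i else u i.

(* Swapping the J-coordinates is an involution of pairs of points of the box,
   so [mix J u v] is uniformly distributed when u and v are. *)
Lemma box_freq_mix b n (J : pred I) X (B : R) : (0 < n)%N ->
  (forall u, in_box b n u -> box_freq b n [pred v | X (mix J u v)] <= B) ->
  box_freq b n X <= B.
Proof.
move=> n0 H; pose T : finType := {ffun I -> 'I_n}.
have T0 : 0 < (n ^ #|I|)%:R :> R by rewrite ltr0n expn_gt0 n0.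
have cT : #|T| = (n ^ #|I|)%N by rewrite card_ffun card_ord.
pose mx (x y : T) : T := [ffun i => if J i then y i else x i].
have mxE x y : mix J (box_point b x) (box_point b y) = box_point b (mx x y).
  by apply/funext => i; rewrite /mix /box_point ffunE; case: (J i).
suff E : \sum_(x : T) box_freq b n [pred v | X (mix J (box_point b x) v)] =
         (n ^ #|I|)%:R * box_freq b n X.
  rewrite -(ler_pM2l T0) -E.
  apply: (@le_trans _ _ (\sum_(x : T) B)).
    by apply: ler_sum => x _; apply: H; exact: box_point_in.
  by rewrite sumr_const -cT mulr_natl.
rewrite /box_freq -mulr_suml mulrA; congr (_ / _).
rewrite -natr_sum -natrM; congr (_%:R).
transitivity (\sum_(x : T) \sum_(y : T) (X (box_point b (mx x y)) : nat))%N.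
  apply: eq_bigr => x _; rewrite -sum1_card big_mkcond /=.
  by apply: eq_bigr => y _; rewrite !inE mxE; case: (X _).
rewrite pair_big /=.
have mxinv : involutive (fun z : T * T => (mx z.1 z.2, mx z.2 z.1)).
  by move=> [x y] /=; congr (_, _); apply/ffunP => i; rewrite !ffunE; case: (J i).
rewrite (reindex_inj (inv_inj mxinv)) /=.
rewrite (eq_bigr (fun z : T * T => (X (box_point b z.1) : nat))); last first.
  move=> [x y] _ /=; congr (nat_of_bool (X (box_point b _))).
  by apply/ffunP => i; rewrite !ffunE; case: (J i).
rewrite -(pair_big xpredT xpredT (fun x y : T => (X (box_point b x) : nat))) /=.
rewrite -cT mulnC -sum1_card big_distrl /= [RHS]big_mkcond /=.
apply: eq_bigr => x _; rewrite sum_nat_const !inE.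
by case: (X _); rewrite ?muln1 ?muln0 ?mul1n.
Qed.

(** Freezing every coordinate but [i0] leaves a product set whose only nontrivial factor is the set
    of bad values of that coordinate. *)
Lemma box_freq_mix1 b n (i0 : I) X (c : nat) : (0 < n)%N ->
  (forall u, in_box b n u ->
     #|[pred t : 'I_n | X (mix (pred1 i0) u (fun i => b i + t%:Z)%R)]| <= c)%N ->
  box_freq b n X <= c%:R / n%:R.
Proof.
move=> n0 H; apply: (@box_freq_mix b n (pred1 i0)) => // u /H {}H.
have n0R : (n%:R : R) != 0 by rewrite pnatr_eq0; lia.
pose F i := if i == i0 then [pred z | X (mix (pred1 i0) u (fun=> z))] else predT.
apply: (@le_trans _ _ (box_freq b n [pred v | [forall i, F i (v i)]])).
  apply: box_freq_le => v _ /= Xv; apply/forallP => i; rewrite /F.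
  case: eqP => // ->; rewrite /=; congr (is_true (X _)): Xv.
  by apply/funext => j; rewrite /mix /=; case: eqP => // ->.
rewrite (box_freq_forall b n F) (bigD1 i0) //= [X in _ * X]big1 => [|i ii0]; last first.
  by rewrite /F (negbTE ii0) (eq_card (B := predT)) ?card_ord ?divff.
rewrite mulr1 ler_wpM2r ?invr_ge0// ler_nat; apply: leq_trans H.
apply: subset_leq_card; apply/fintype.subsetP => t; rewrite !inE /F eqxx /=.
congr (is_true (X _)); apply/funext => j; rewrite /mix /=.
by case: eqP => // ->.
Qed.

End BoxFrequency.

(** * Residues and periodic predicates *)

Section Residues.
Variable R : realType.

(** Elements of one residue class modulo [Q] are separated by their quotients [t %/ Q], which take
    at most [n %/ Q + 1] values. *)
Lemma card_residue_le (n Q : nat) (b a : int) : (0 < Q)%N ->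
  (#|[pred t : 'I_n | (Q%:Z %| (b + t%:Z - a)%R)%Z]| <= (n %/ Q).+1)%N.
Proof.
move=> Q0.
have bnd (t : 'I_n) : (t %/ Q < (n %/ Q).+1)%N by rewrite ltnS leq_div2r // ltnW.
pose f (t : 'I_n) : 'I_(n %/ Q).+1 := Ordinal (bnd t).
rewrite -[leqRHS]card_ord -(card_in_imset (f := f)) ?max_card // => t1 t2.
rewrite !inE => h1 h2 /(congr1 val)/= e.
apply: val_inj; rewrite /= (divn_eq t1 Q) (divn_eq t2 Q) e; congr (_ + _)%N.
have : (Q%:Z %| t1%:Z - t2%:Z)%Z.
  have -> : t1%:Z - t2%:Z = (b + t1%:Z - a) - (b + t2%:Z - a) by ring.
  exact: rpredB.
by rewrite -eqz_mod_dvd !modz_nat => /eqP [].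
Qed.

Lemma card_residue_ge (n Q : nat) (b a : int) : (0 < Q)%N ->
  (n %/ Q <= #|[pred t : 'I_n | (Q%:Z %| (b + t%:Z - a)%R)%Z]|)%N.
Proof.
move=> Q0.
have [r rQ dr] : exists2 r : nat, (r < Q)%N & (Q%:Z %| b + r%:Z - a)%Z.
  exists `|((a - b) %% Q%:Z)%Z|%N.
    by rewrite -ltz_nat gez0_abs ?modz_ge0 ?ltz_pmod; lia.
  rewrite gez0_abs; last by rewrite modz_ge0//; lia.
  rewrite (_ : b + _ - a = - (((a - b) %/ Q%:Z)%Z * Q%:Z)).
    by rewrite rpredN dvdz_mull.
  have := divz_eq (a - b) Q%:Z; move: ((_ %/ _)%Z * _) (_ %% _)%Z => q r; lia.
have bnd (y : 'I_(n %/ Q)) : (y * Q + r < n)%N.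
  have := ltn_ord y; have := leq_trunc_div n Q; nia.
pose g (y : 'I_(n %/ Q)) : 'I_n := Ordinal (bnd y).
have gI : injective g.
  move=> y1 y2 /(congr1 val)/= e; apply: val_inj => /=.
  by move/addIn: e => /eqP; rewrite eqn_pmul2r// => /eqP.
rewrite -{1}[(n %/ Q)%N]card_ord -(card_imset predT gI).
apply: subset_leq_card; apply/fintype.subsetP => _ /imsetP[y _ ->].
rewrite !inE /= PoszD PoszM.
rewrite (_ : b + _ - a = y%:Z * Q%:Z + (b + r%:Z - a)); last by ring.
by rewrite rpredD ?dvdz_mull.
Qed.

Lemma residue_freq (n Q : nat) (b a : int) : (0 < n)%N -> (0 < Q)%N ->
  (Q%:R^-1 : R) - n%:R^-1
    <= (#|[pred t : 'I_n | (Q%:Z %| b + t%:Z - a)%Z]|%:R / n%:R : R)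
    <= Q%:R^-1 + n%:R^-1.
Proof.
move=> n0 Q0.
have n0R : 0 < n%:R :> R by rewrite ltr0n.
have Q0R : 0 < Q%:R :> R by rewrite ltr0n.
have E (x : R) : (x / n%:R + n%:R^-1 = (x + 1) / n%:R) by rewrite mulrDl mul1r.
have lo := card_residue_ge n b a Q0; have hi := card_residue_le n b a Q0.
have h1 := divn_eq n Q; have h2 := ltn_pmod n Q0.
apply/andP; split.
- rewrite lerBlDr E ler_pdivlMr// ler_pdivrMl//.
  rewrite natr1 -natrM ler_nat; nia.
- have -> : Q%:R^-1 + n%:R^-1 = (n%:R + Q%:R) / Q%:R / n%:R :> R.
    by field; rewrite !gt_eqF.
  rewrite ler_pM2r ?invr_gt0// ler_pdivlMr// -natrM -natrD ler_nat.
  nia.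
Qed.

Lemma residue_freq_cvg (Q : nat) (b : nat -> int) (a : int) : (0 < Q)%N ->
  (#|[pred t : 'I_n | (Q%:Z %| b n + t%:Z - a)%Z]|%:R / n%:R : R)
    @[n --> \oo] --> (Q%:R^-1 : R).
Proof.
(* Shifting discards [n = 0] and turns the error [1/n] into [harmonic n]. *)
move=> Q0; rewrite -cvg_shiftS /=.
have H (s : R) : Q%:R^-1 + s * harmonic n @[n --> \oo] --> (Q%:R^-1 : R).
  rewrite -[X in _ --> X]addr0 -[X in _ --> _ + X](mulr0 s).
  by apply: cvgD; [exact: cvg_cst|apply: cvgMr; exact: cvg_harmonic].
apply: (squeeze_cvgr _ (H (-1)) (H 1)); near=> n.
by rewrite mulN1r mul1r; exact: residue_freq.
Unshelve. all: by end_near. Qed.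

End Residues.

Section Periodic.
Variables (R : realType) (I : finType).
Implicit Types (u v : I -> int) (X Y : pred (I -> int)).

Definition periodic (Q : nat) X :=
  forall u v, (forall i, (Q%:Z %| u i - v i)%Z) -> X u = X v.

Lemma periodicW Q Q' X : (Q %| Q')%N -> periodic Q X -> periodic Q' X.
Proof.
move=> QQ' pX u v uv; apply: pX => i; apply: dvdz_trans (uv i).
by rewrite /dvdz.
Qed.

(** The box splits by residues modulo [Q]; a periodic predicate is constant on each piece, and each
    piece is a product set. *)
Lemma box_freq_residues (b : I -> int) n Q X : (0 < Q)%N -> periodic Q X ->
  box_freq R b n X =
  \sum_(a : {ffun I -> 'I_Q} | X (box_point (fun=> 0) a))
    \prod_i (#|[pred t : 'I_n | (Q%:Z %| b i + t%:Z - (a i)%:Z)%Z]|%:R / n%:R).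
Proof.
move=> Q0 pX.
have bnd (z : int) : (`|(z %% Q%:Z)%Z| < Q)%N.
  by rewrite -ltz_nat gez0_abs ?modz_ge0 ?ltz_pmod; lia.
pose red (u : I -> int) : {ffun I -> 'I_Q} := [ffun i => Ordinal (bnd (u i))].
have redE u (a : {ffun I -> 'I_Q}) :
    (red u == a) = [forall i, (Q%:Z %| u i - (a i)%:Z)%Z].
  apply/eqP/forallP => [<- i|H].
    rewrite ffunE /= gez0_abs; last by rewrite modz_ge0//; lia.
    by rewrite {1}(divz_eq (u i) Q%:Z) addrK dvdz_mull.
  apply/ffunP => i; apply: val_inj; rewrite ffunE /=.
  have := H i; rewrite -eqz_mod_dvd modz_nat => /eqP ->.
  by rewrite modn_small.
pose F (a : {ffun I -> 'I_Q}) i := [pred z | (Q%:Z %| z - (a i)%:Z)%Z].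
rewrite (eq_bigr (fun a => box_freq R b n [pred u | [forall i, F a i (u i)]])).
  rewrite -mulr_suml; congr (_ / _); rewrite -natr_sum; congr (_%:R).
  rewrite -sum1_card.
  rewrite (partition_big (fun x : {ffun I -> 'I_n} => red (box_point b x))
    (fun a => X (box_point (fun=> 0) a))) /=; last first.
    move=> x; rewrite !inE => Xx; rewrite -(pX (box_point b x))// => i.
    suff /forallP/(_ i) : [forall i, (Q%:Z %| box_point b x i
        - (red (box_point b x) i)%:Z)%Z] by rewrite /box_point add0r.
    by rewrite -redE.
  apply: eq_bigr => a Xa; rewrite -sum1_card; apply: eq_bigl => x.
  rewrite !inE redE andb_idl// => /forallP H; rewrite (pX _ (box_point (fun=> 0) a))//.
by move=> a _; rewrite (box_freq_forall R b n (F a)).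
Qed.

(** Every residue vector has the same limiting frequency, so only the number of admissible ones
    matters, and the box of side [Q] at the origin counts exactly those. *)
Lemma box_freq_periodic_cvg (b : nat -> I -> int) Q X :
  (0 < Q)%N -> periodic Q X ->
  box_freq R (b n) n X @[n --> \oo] --> box_freq R (fun=> 0) Q X.
Proof.
move=> Q0 pX; under eq_fun do rewrite (box_freq_residues _ _ Q0 pX).
have -> : box_freq R (fun=> 0) Q X =
    \sum_(a : {ffun I -> 'I_Q} | X (box_point (fun=> 0) a)) \prod_(i : I) Q%:R^-1.
  by rewrite sumr_const prodr_const /box_freq natrX exprVn mulr_natl.
apply: cvg_big => [|a _]; first exact: add_continuous.
apply: cvg_big => [|i _]; first exact: mul_continuous.
exact: residue_freq_cvg.
Qed.

(** By the Chinese remainder theorem, reduction modulo [Q1] and [Q2] identifies the box of side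
    [Q1 * Q2] with the product of the two smaller boxes. *)
Lemma box_freq_coprime (Q1 Q2 : nat) X Y : coprime Q1 Q2 ->
  (0 < Q1)%N -> (0 < Q2)%N -> periodic Q1 X -> periodic Q2 Y ->
  box_freq R (fun=> 0) (Q1 * Q2) [pred u | X u && Y u] =
  box_freq R (fun=> 0) Q1 X * box_freq R (fun=> 0) Q2 Y.
Proof.
move=> co Q10 Q20 pX pY.
pose red Q (Q0 : (0 < Q)%N) (x : {ffun I -> 'I_(Q1 * Q2)}) : {ffun I -> 'I_Q} :=
  [ffun i => Ordinal (ltn_pmod (x i) Q0)].
have redE Q (Q0 : (0 < Q)%N) x i : (Q%:Z %| box_point (fun=> 0) x i
    - box_point (fun=> 0) (red Q Q0 x) i)%Z.
  rewrite /box_point !add0r ffunE /= -eqz_mod_dvd !modz_nat.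
  by rewrite modn_mod.
pose h (x : {ffun I -> 'I_(Q1 * Q2)}) := (red Q1 Q10 x, red Q2 Q20 x).
have hI : injective h.
  move=> x y [] /ffunP e1 /ffunP e2; apply/ffunP => i; apply: val_inj => /=.
  have := congr1 val (e1 i); have := congr1 val (e2 i); rewrite !ffunE /= => f2 f1.
  rewrite -[LHS](modn_small (ltn_ord (x i))) -[RHS](modn_small (ltn_ord (y i))).
  by apply/eqP; rewrite chinese_remainder// f1 f2 !eqxx.
have hB : bijective h.
  apply: inj_card_bij => //.
  by rewrite card_prod !card_ffun !card_ord expnMn.
rewrite /box_freq mulf_div -!natrM -expnMn; congr (_%:R / _).
rewrite -cardX -!sum1_card (reindex h) /=; last exact: onW_bij.
apply: eq_bigl => x; rewrite !inE /=.
by congr (_ && _); [apply: pX|apply: pY] => i; exact: redE.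
Qed.

End Periodic.

(** * Primitivity modulo every prime *)

Lemma row_free_col_mx1 (F : fieldType) (m d : nat) (v : 'rV[F]_d) (A : 'M[F]_(m, d)) :
  row_free (col_mx v A) = row_free A && ~~ (v <= A)%MS.
Proof.
rewrite -!row_leq_rank -addsmxE.
have [vA|vA] := boolP (v <= A)%MS.
  rewrite andbF (addsmx_idPr vA); apply/negbTE; rewrite -ltnNge.
  by rewrite add1n ltnS rank_leq_row.
rewrite andbT; apply/idP/idP => [H|H].
  have := leq_trans H (mxrank_adds_leqif v A).1.
  by have := rank_leq_row v; lia.
have : (\rank A < \rank (v + A)%MS)%N.
  rewrite (ltn_leqif (mxrank_leqif_sup (addsmxSr v A))).
  by apply: contra vA; apply: submx_trans; exact: addsmxSl.
by move: H; lia.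
Qed.

(** Rows are added one at a time: a new row must avoid the span of the [m] independent rows already
    chosen, which has [#|F| ^ m] elements. *)
Lemma card_row_free (F : finFieldType) (m d : nat) : (m <= d)%N ->
  #|[pred A : 'M[F]_(m, d) | row_free A]| =
  (\prod_(j < m) (#|F| ^ d - #|F| ^ j))%N.
Proof.
elim: m => [_|m IH md].
  rewrite big_ord0 -(card1 (0 : 'M[F]_(0, d))); apply: eq_card => A.
  by rewrite !inE flatmx0 eqxx -row_leq_rank.
rewrite big_ord_recr /= -IH ?(ltnW md)// -sum_nat_const -sum1_card.
pose h (x : 'M[F]_(m, d) * 'rV[F]_d) : 'M[F]_(1 + m, d) := col_mx x.2 x.1.
rewrite (reindex h) /=; last first.
  exists (fun A : 'M[F]_(1 + m, d) => (dsubmx A, usubmx A)) => [[A v]|A] _.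
    by rewrite /h /= col_mxKd col_mxKu.
  by rewrite /h /= vsubmxK.
rewrite (eq_bigl (fun x : 'M[F]_(m, d) * 'rV[F]_d =>
   row_free x.1 && ~~ (x.2 <= x.1)%MS)); last first.
  by move=> [A v]; rewrite inE row_free_col_mx1.
rewrite -(pair_big_dep (fun A : 'M[F]_(m, d) => row_free A)
  (fun A (v : 'rV_d) => ~~ (v <= A)%MS) (fun _ _ => 1%N)) /=.
apply: eq_bigr => A frA; rewrite sum1_card.
have <- : #|[pred v : 'rV_d | (v <= A)%MS]| = (#|F| ^ m)%N.
  rewrite -[m in RHS]mul1n -card_mx.
  rewrite -(card_imset predT (row_free_inj frA (m := 1))).
  by apply: eq_card => v; rewrite !inE; apply/submxP/imsetP => -[u]; exists u.
have := cardC [pred v : 'rV_d | (v <= A)%MS].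
rewrite card_mx mul1n => <-; rewrite addKn.
by apply: eq_card => v; rewrite !inE.
Qed.

(** In the Smith form [S = L D U], a diagonal entry divisible by a prime [p] would make row [i] of
    [invmx L], which is nonzero modulo [p], a kernel vector of [S] modulo [p]. Hence all diagonal
    entries are units. *)
Lemma int_right_inverse (m d : nat) (S : 'M[int]_(m, d)) :
  (forall p, prime p -> row_free (map_mx (intr : int -> 'F_p) S)) ->
  exists T : 'M[int]_(d, m), S *m T = 1%:M.
Proof.
move=> frS; have [L uL [U uU [e _ SE]]] := int_Smith_normal_form S.
set D := (X in L *m X) in SE.
have DE : D *m U = invmx L *m S by rewrite SE -mulmxA mulKmx.
have notzero i p : prime p -> map_mx (intr : int -> 'F_p) (row i D) <> 0.
  move=> pp Di0; pose u := row i (invmx L).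
  have uS : u *m S = row i D *m U by rewrite -!row_mul DE.
  have u0 : map_mx (intr : int -> 'F_p) u = 0.
    apply: (row_free_inj (frS p pp)).
    by rewrite -map_mxM uS map_mxM Di0 !mul0mx.
  have : map_mx (intr : int -> 'F_p) (u *m L) = 0 by rewrite map_mxM u0 mul0mx.
  rewrite -row_mul mulVmx// => /rowP/(_ i); rewrite !mxE eqxx.
  by move/eqP; rewrite oner_eq0.
have De (i : 'I_m) : exists2 i' : 'I_d, i' = i :> nat & e`_i * e`_i = 1.
  (* If [d <= i], row [i] of [D] is zero and any prime gives a contradiction; 2 is taken. *)
  have [di|id] := leqP d i.
    case: (notzero i 2%N) => //; apply/rowP => j; rewrite !mxE.
    by rewrite gtn_eqF// (leq_trans (ltn_ord j)).
  exists (Ordinal id) => //.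
  have [p1|pe] : `|(e`_i)%R|%N = 1%N \/ exists2 p, prime p & (p%:Z %| e`_i)%Z.
    have [->|e0] := eqVneq e`_i 0; first by right; exists 2%N; rewrite ?dvdz0.
    have [->|e1] := eqVneq `|(e`_i)%R|%N 1%N; first by left.
    right; exists (pdiv `|(e`_i)%R|%N); first by apply: pdiv_prime; lia.
    by rewrite dvdzE /= pdiv_dvd.
  by rewrite -expr2 -[e`_i ^+ 2]gez0_abs ?sqr_ge0// abszX p1 exp1n.
  case: pe => p pp pe; case: (notzero i p) => //; apply/rowP => j; rewrite !mxE.
  case: eqP => _; last by rewrite mulr0n.
  by apply/eqP; rewrite mulr1n -(dvdz_pcharf (pchar_Fp pp)).
(* [E] is the transpose of [D]; it is a right inverse of [D] because each diagonal entry squares to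
   1. *)
pose E : 'M[int]_(d, m) := \matrix_(j, i) (e`_i *+ (i == j :> nat)).
exists (invmx U *m E *m invmx L).
rewrite SE -!mulmxA [U *m _]mulmxA mulmxV// mul1mx [D *m _]mulmxA.
suff -> : D *m E = 1%:M by rewrite mul1mx mulmxV.
apply/matrixP => i k; rewrite !mxE; have [i' i'E ei] := De i.
rewrite (bigD1 i') //= big1 ?addr0 => [|j ji]; last first.
  rewrite !mxE [(i == j :> nat)](_ : _ = false) ?mul0r//.
  by apply: contraNF ji => /eqP ij; apply/eqP/val_inj; rewrite /= i'E.
rewrite !mxE i'E eqxx mulr1n eq_sym; have [<-|ik] := eqVneq i k.
  by rewrite eqxx mulr1n ei.
by rewrite [(i == k :> nat)](negbTE ik) mulr0n mulr0.
Qed.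

(** For a primitive [S], a relation [c] modulo [p] gives [c S = p w] with [w] in the lattice;
    expanding [w] in the basis and using uniqueness shows that [p] divides [c]. Conversely, given an
    integral right inverse [T], a lattice vector [v] equals [(v T) S], and these coefficients are
    unique because [c S T = c]. *)
Lemma primitiveP (R : realType) (m d : nat) (S : 'M[int]_(m, d)) :
  primitive R S <->
  forall p, prime p -> row_free (map_mx (intr : int -> 'F_p) S).
Proof.
have sumE (c : {ffun 'I_m -> int}) :
    \sum_(k < m) c k *: row k S = (\row_k c k) *m S.
  by rewrite mulmx_sum_row; apply: eq_bigr => k _; rewrite mxE.
split=> [[_ [_ basS]] p p_pr|/int_right_inverse[T ST]].
  apply: inj_row_free => v vS0.
  pose c : {ffun 'I_m -> int} := [ffun k => (v 0 k : nat)%:Z].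
  have cv : map_mx (intr : int -> 'F_p) (\row_k c k) = v.
    by apply/rowP => k; rewrite !mxE ffunE; exact: natr_Zp.
  pose w : 'rV[int]_d := \row_j ((((\row_k c k) *m S) 0 j)%R %/ p%:Z)%Z.
  have wE : p%:Z *: w = (\row_k c k) *m S.
    apply/rowP => j; rewrite !mxE mulrC divzK//.
    rewrite (dvdz_pcharf (pchar_Fp p_pr)).
    have /rowP/(_ j) : map_mx (intr : int -> 'F_p) ((\row_k c k) *m S) = 0.
      by rewrite map_mxM cv vS0.
    by rewrite !mxE => ->.
  have p0 : (p%:Z%:~R : R) != 0 by rewrite pnatr_eq0; case: p p_pr {v vS0 c cv w wE}.
  have wS : span_lattice R S w.
    rewrite /span_lattice /=; apply/submxP.
    exists (p%:Z%:~R^-1 *: map_mx intr (\row_k c k)).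
    by rewrite -scalemxAl -map_mxM -wE map_mxZ scalerA mulVf// scale1r.
  have [a [wa _]] := basS w wS.
  have cS : span_lattice R S ((\row_k c k) *m S).
    by rewrite /span_lattice /= map_mxM submxMl.
  have [a' [_ a'u]] := basS _ cS.
  have ac : c = [ffun k => p%:Z * a k].
    rewrite -(a'u c) ?sumE// -(a'u [ffun k => p%:Z * a k])//.
    rewrite -wE wa !sumE scalemxAl; congr (_ *m _).
    by apply/rowP => k; rewrite !mxE ffunE.
  rewrite -cv ac; apply/rowP => k; rewrite !mxE ffunE rmorphM /=.
  by rewrite -[(p : int)%:~R]/(p%:R) pchar_Fp_0// mul0r.
have STR : map_mx (intr : int -> R) S *m map_mx intr T = 1%:M.
  by rewrite -map_mxM ST map_mx1.
split; first by apply/row_freeP; exists (map_mx intr T).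
split=> [k|v]; first by rewrite /span_lattice /= map_row row_sub.
rewrite /span_lattice /= => /submxP[x vx].
exists [ffun k => (v *m T) 0 k]; split; last first.
  by move=> c; rewrite sumE => ->; apply/ffunP => k; rewrite ffunE -mulmxA ST mulmx1 mxE.
rewrite sumE.
have -> : \row_k [ffun k => (v *m T) 0 k] k = v *m T.
  by apply/rowP => k; rewrite mxE ffunE.
have : map_mx (intr : int -> R) v = map_mx intr (v *m T *m S).
  by rewrite !map_mxM vx -[x *m _ *m _]mulmxA STR mulmx1.
move=> /rowP H; apply/rowP => j; have := H j.
by rewrite mxE [RHS]mxE => /intr_inj.
Qed.

(** * Euler product *)

Definition primes_upto (M : nat) : seq nat := [seq p <- iota 0 M.+1 | prime p].

Lemma mem_primes_upto M p : (p \in primes_upto M) = prime p && (p <= M)%N.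
Proof. by rewrite mem_filter mem_iota add0n ltnS. Qed.

Section EulerProduct.
Variables (R : realType) (s : nat).
Hypothesis s_ge2 : (2 <= s)%N.

Definition sieve (ps : seq nat) (k : nat) : bool := all (fun p => ~~ (p %| k)%N) ps.

Definition sifted_sum (ps : seq nat) (N : nat) : R :=
  \sum_(1 <= k < N.+1 | sieve ps k) (k%:R ^+ s)^-1.

(** The terms removed are those with [k = p l] and [l <= N %/ p], and [p l] survives [ps] exactly
    when [l] does, since [p] is a prime outside [ps]. In the limit this yields the Euler factor
    [1 - p^-s]. *)
Lemma sifted_sum_cons p ps N : prime p -> all prime ps -> p \notin ps ->
  sifted_sum (p :: ps) N =
  sifted_sum ps N - (p%:R ^+ s)^-1 * sifted_sum ps (N %/ p).
Proof.
move=> pp psp pps; have p0 := prime_gt0 pp.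
rewrite /sifted_sum; elim: N => [|N IH].
  by rewrite div0n !big_geq ?mulr0 ?subr0.
rewrite !(big_mkcond (sieve _)) /= in IH *.
rewrite big_nat_recr //= {}IH [in RHS]big_nat_recr //= divnS //.
have [dv|ndv] := boolP (p %| N.+1)%N; last first.
  by rewrite add0n /=; case: ifP => _; ring.
rewrite add1n [in X in _ = _ - X]big_nat_recr //=.
have NE : N.+1 = ((N %/ p).+1 * p)%N by rewrite -[LHS](divnK dv) divnS // dv.
have -> : sieve ps N.+1 = sieve ps (N %/ p).+1.
  apply: eq_in_all => q qps; rewrite NE Euclid_dvdM ?(allP psp)//.
  rewrite (dvdn_prime2 (allP psp q qps) pp) orbC (_ : (q == p) = false)//.
  exact: negbTE (memPn pps q qps).
case: ifP => _; last by ring.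
have -> : N.+1%:R = (N %/ p).+1%:R * p%:R :> R by rewrite -natrM -NE.
by rewrite exprMn invfM; ring.
Qed.

(** The sum telescopes, from [k^-s <= k^-2 <= 1/(k-1) - 1/k]. *)
Lemma tail_sum_le M N : (0 < M)%N -> (M <= N)%N ->
  \sum_(M.+1 <= k < N.+1) (k%:R ^+ s)^-1 <= M%:R^-1 - N%:R^-1 :> R.
Proof.
move=> M0; elim: N => [|N IH] MN; first by lia.
have [NM|ME] : (M <= N)%N \/ M = N.+1 by lia.
  rewrite big_nat_recr //=; apply: le_trans (lerD (IH NM) (lexx _)) _.
  have N0 : 0 < N%:R :> R by rewrite ltr0n; lia.
  have N10 : 0 < N.+1%:R :> R by [].
  apply: (@le_trans _ _ (M%:R^-1 - N%:R^-1 + (N%:R * N.+1%:R)^-1)); last first.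
    rewrite -natr1; have -> : (N%:R * (N%:R + 1))^-1 = N%:R^-1 - (N%:R + 1)^-1 :> R.
      by field; rewrite natr1 !gt_eqF.
    by rewrite addrA subrK.
  rewrite lerD2l lef_pV2 ?posrE ?mulr_gt0 ?exprn_gt0//.
  apply: (@le_trans _ _ (N.+1%:R ^+ 2)); last by rewrite ler_weXn2l ?ler1n.
  by rewrite expr2 ler_pM2r// ler_nat.
by rewrite ME big_geq ?subrr.
Qed.

Lemma sifted_sum_nil_cvg : sifted_sum [::] N @[N --> \oo] --> zeta (s%:R : R).
Proof.
have E : sifted_sum [::] = series (riemannR (s%:R : R)).
  apply/funext => N; rewrite /sifted_sum /series /= big_add1 /=.
  by apply: eq_bigr => k _; rewrite /riemannR powR_mulrn.
rewrite /zeta -E; apply: nondecreasing_is_cvgn.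
  move=> N N' NN'; rewrite /sifted_sum [leRHS](big_cat_nat _ (n := N.+1)) //=.
  by rewrite lerDl sumr_ge0// => k _; rewrite invr_ge0 exprn_ge0.
exists 2 => _ [N _ <-]; rewrite /sifted_sum; case: N => [|N]; first by rewrite big_geq.
rewrite big_ltn //= expr1n invr1 (_ : 2 = 1 + 1)// lerD2l.
apply: le_trans (tail_sum_le _ _) _ => //.
by rewrite invr1 lerBlDr lerDl.
Qed.

Lemma sifted_sum_cvg ps : uniq ps -> all prime ps ->
  sifted_sum ps N @[N --> \oo] -->
  zeta (s%:R : R) * \prod_(p <- ps) (1 - (p%:R ^+ s)^-1).
Proof.
elim: ps => [_ _|p ps IH /andP[pps ups] /andP[pp psp]].
  by rewrite big_nil mulr1; exact: sifted_sum_nil_cvg.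
under eq_fun do rewrite sifted_sum_cons//.
rewrite big_cons mulrCA mulrBl mul1r.
apply: cvgB; first exact: IH.
apply: cvgMr; apply: (cvg_comp (divn^~ p) (sifted_sum ps)); last exact: IH.
exact: cvg_divnr (prime_gt0 pp).
Qed.

(** Sieving by all primes up to [M] keeps [k = 1] and removes every [1 < k <= M], since the least
    prime factor of such a [k] is at most [M]. What survives beyond [M] is bounded by
    [tail_sum_le]. *)
Lemma euler_product_bounds M : (0 < M)%N ->
  1 <= zeta (s%:R : R) * \prod_(p <- primes_upto M) (1 - (p%:R ^+ s)^-1)
    <= 1 + M%:R^-1.
Proof.
move=> M0; have cv := @sifted_sum_cvg (primes_upto M) (filter_uniq _ (iota_uniq _ _))
  (filter_all _ _).
have s1 : sieve (primes_upto M) 1.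
  apply/allP => p; rewrite mem_primes_upto dvdn1 => /andP[pp _].
  by rewrite gtn_eqF// prime_gt1.
rewrite -(cvg_lim _ cv)//; apply/andP; split.
- apply: limr_ge; first exact: cvgP cv.
  near=> N; have N0 : (0 < N)%N by near: N; exists 1%N.
  rewrite /sifted_sum big_ltn_cond // s1 expr1n invr1 lerDl.
  by apply: sumr_ge0 => k _; rewrite invr_ge0 exprn_ge0.
- apply: limr_le; first exact: cvgP cv.
  near=> N; have MN : (M <= N)%N by near: N; exists M.
  rewrite /sifted_sum big_ltn_cond; last by lia.
  rewrite s1 expr1n invr1 lerD2l.
  rewrite (big_cat_nat (n := M.+1)) //=.
  rewrite big_nat_cond big_pred0 ?add0r; last first.
    move=> k; apply/negbTE/negP => /andP[/andP[k1 kM] /allP sk].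
    have /sk : pdiv k \in primes_upto M.
      rewrite mem_primes_upto pdiv_prime//=.
      by rewrite (leq_trans (pdiv_leq _))//; lia.
    by rewrite pdiv_dvd.
  apply: (@le_trans _ _ (\sum_(M.+1 <= k < N.+1) (k%:R ^+ s)^-1)).
    rewrite big_mkcond; apply: ler_sum => k _.
    by case: ifP => _; rewrite ?invr_ge0 ?exprn_ge0.
  by apply: le_trans (tail_sum_le _ _) _ => //; rewrite lerBlDr lerDl.
Unshelve. all: by end_near. Qed.

Lemma zeta_ge1 : 1 <= zeta (s%:R : R).
Proof.
have /andP[] := @euler_product_bounds 1 isT.
by rewrite (_ : primes_upto 1 = [::])// big_nil mulr1.
Qed.

Lemma euler_product_cvg :
  \prod_(p <- primes_upto M) (1 - (p%:R ^+ s)^-1) @[M --> \oo] -->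
  (zeta (s%:R : R))^-1.
Proof.
have z0 : 0 < zeta (s%:R : R) by apply: lt_le_trans zeta_ge1.
rewrite -cvg_shiftS.
set z := (zeta (s%:R : R))^-1.
have H : z * (1 + harmonic M) @[M --> \oo] --> z * (1 + 0).
  by apply: cvgMr; apply: cvgD; [exact: cvg_cst|exact: cvg_harmonic].
rewrite addr0 mulr1 in H.
apply: (squeeze_cvgr _ (cvg_cst z) H); near=> M.
have /andP[lo hi] := @euler_product_bounds M.+1 isT.
by rewrite -{1}[z]mulr1 /z ler_pdivrMl// ler_pdivlMl// lo hi.
Unshelve. all: by end_near. Qed.

End EulerProduct.

(** * Small primes *)

Lemma coprime_prod_primes p ps : prime p -> all prime ps -> p \notin ps ->
  coprime p (\prod_(q <- ps) q).
Proof.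
rewrite coprime_sym => pp; elim: ps => [|q ps IH]; first by rewrite big_nil coprime1n.
rewrite inE negb_or => /andP[qp psp] /andP[pq pps].
rewrite big_cons coprimeMl IH// andbT prime_coprime//.
by rewrite dvdn_prime2// eq_sym.
Qed.

Section FullRank.
Variables (R : realType) (m d : nat).
Implicit Types u v : 'I_m * 'I_d -> int.

Definition mx_of u : 'M[int]_(m, d) := \matrix_(k, i) u (k, i).

Definition full_rank p : pred ('I_m * 'I_d -> int) :=
  fun u => row_free (map_mx (intr : int -> 'F_p) (mx_of u)).

Lemma periodic_full_rank p : prime p -> periodic p (full_rank p).
Proof.
move=> pp u v uv; rewrite /full_rank; congr row_free; apply/matrixP => k i.
rewrite !mxE; apply/eqP; rewrite -subr_eq0 -rmorphB /=.
by rewrite -(dvdz_pcharf (pchar_Fp pp)).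
Qed.

(** Reduction modulo [p] is a bijection from the box of side [p] onto the matrices over ['F_p], so
    [card_row_free] applies; its [m] factors are each divided by [p^d]. *)
Lemma box_freq_full_rank p : prime p -> (m <= d)%N ->
  box_freq R (fun=> 0) p (full_rank p) =
  \prod_(j < m) (1 - (p%:R ^+ (d - j))^-1).
Proof.
move=> pp md; have p0 : p%:R != 0 :> R by rewrite pnatr_eq0 -lt0n prime_gt0.
pose h (x : {ffun 'I_m * 'I_d -> 'I_p}) : 'M['F_p]_(m, d) :=
  map_mx (intr : int -> 'F_p) (mx_of (box_point (fun=> 0) x)).
have hB : bijective h.
  apply: inj_card_bij.
    move=> x y /matrixP xy; apply/ffunP => -[k i]; apply: val_inj.
    have := xy k i; rewrite !mxE /box_point !add0r => /(congr1 val).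
    rewrite /= -!pmulrn !val_Fp_nat//.
    by rewrite !modn_small.
  by rewrite card_mx card_Fp// card_ffun card_prod !card_ord.
rewrite /box_freq card_prod !card_ord.
have -> : #|[pred x : {ffun 'I_m * 'I_d -> 'I_p} |
    full_rank p (box_point (fun=> 0) x)]| = (\prod_(j < m) (p ^ d - p ^ j))%N.
  rewrite -[in RHS](card_Fp pp) -card_row_free// -!sum1_card.
  by rewrite [RHS](reindex h) //=; exact: onW_bij.
rewrite mulnC expnM natrX -[X in _ / _ ^+ X](card_ord m) -prodr_const natr_prod -prodf_div.
apply: eq_bigr => j _; have jd : (j <= d)%N by rewrite (leq_trans (ltnW (ltn_ord j))).
rewrite natrB ?leq_pexp2l ?prime_gt0// !natrX mulrBl divff ?expf_neq0//.
by rewrite -[X in _ - _ * (_ ^+ X)^-1](subnK jd) exprD invfM mulrCA divff ?expf_neq0// mulr1.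
Qed.

Lemma box_freq_full_rank_all ps : uniq ps -> all prime ps -> (m <= d)%N ->
  box_freq R (fun=> 0) (\prod_(p <- ps) p) (fun u => all (full_rank^~ u) ps) =
  \prod_(p <- ps) \prod_(j < m) (1 - (p%:R ^+ (d - j))^-1).
Proof.
(* The induction also carries positivity of the modulus and periodicity, which [box_freq_coprime]
   requires. *)
move=> ups aps md; suff [//] : box_freq R (fun=> 0) (\prod_(p <- ps) p)
    (fun u => all (full_rank^~ u) ps) =
  \prod_(p <- ps) \prod_(j < m) (1 - (p%:R ^+ (d - j))^-1)
  /\ (0 < \prod_(p <- ps) p)%N
  /\ periodic (\prod_(p <- ps) p) (fun u => all (full_rank^~ u) ps).
elim: ps ups aps => [_ _|p ps IH /andP[pps ups] /andP[pp aps]].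
  by rewrite !big_nil box_freqT.
have [E [ps0 per]] := IH ups aps; have p0 := prime_gt0 pp.
have pper := periodic_full_rank pp.
have co := coprime_prod_primes pp aps pps.
rewrite !big_cons /=; split; last split.
- by rewrite (box_freq_coprime R co p0 ps0 pper per) E box_freq_full_rank.
- by rewrite muln_gt0 p0.
- move=> u v uv; congr andb.
    by apply: (periodicW _ pper uv); rewrite dvdn_mulr.
  by apply: (periodicW _ per uv); rewrite dvdn_mull.
Qed.

Lemma box_freq_small_primes_cvg (b : nat -> 'I_m * 'I_d -> int) M : (m <= d)%N ->
  box_freq R (b n) n (fun u => all (full_rank^~ u) (primes_upto M))
    @[n --> \oo] -->
  (\prod_(j < m) \prod_(p <- primes_upto M) (1 - (p%:R ^+ (d - j))^-1) : R).
Proof.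
move=> md; have aps : all prime (primes_upto M) by exact: filter_all.
have ups : uniq (primes_upto M) by exact/filter_uniq/iota_uniq.
rewrite exchange_big /= -(box_freq_full_rank_all ups aps md).
apply: box_freq_periodic_cvg.
  rewrite big_seq prodn_cond_gt0// => p /(allP aps); exact: prime_gt0.
move=> u v uv; apply: eq_in_all => p pps.
apply: (periodicW _ (periodic_full_rank (allP aps p pps)) uv).
by rewrite (big_rem p)//= dvdn_mulr.
Qed.

End FullRank.

(** * Primes between M and n *)

Section MiddlePrimes.
Variables (R : realType) (m d : nat).
Hypothesis m_lt_d : (m < d)%N.

Lemma card_Fp_residue_le (n p : nat) (b : int) (x : 'F_p) : prime p ->
  (#|[pred t : 'I_n | (b + t%:Z)%:~R == x]| <= (n %/ p).+1)%N.
Proof.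
move=> pp; apply: leq_trans (card_residue_le n b (x : nat)%:Z (prime_gt0 pp)).
apply: subset_leq_card; apply/fintype.subsetP => t; rewrite !inE => /eqP tx.
rewrite (dvdz_pcharf (pchar_Fp pp)) rmorphB /= tx subr_eq0; apply/eqP.
by rewrite -[RHS]/((x : nat)%:R) natr_Zp.
Qed.

(** With the other rows frozen, each of the [d] entries of row [i] must lie in a prescribed residue
    class, and [(n %/ p + 1) / n <= 2 / p] because [p <= n]. *)
Lemma box_freq_row_combination (b : 'I_m * 'I_d -> int) n p (i : 'I_m)
    (c : 'rV['F_p]_m.-1) : prime p -> (p <= n)%N ->
  box_freq R b n (fun u =>
    let M := map_mx (intr : int -> 'F_p) (mx_of u) in row i M == c *m row' i M)
  <= (2 / p%:R) ^+ d.
Proof.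
move=> pp pn; have p0 := prime_gt0 pp; have n0 : (0 < n)%N by rewrite (leq_trans p0).
apply: (@box_freq_mix _ _ _ _ (fun ki => ki.1 == i)) => // u _ /=.
pose x := c *m row' i (map_mx (intr : int -> 'F_p) (mx_of u)).
pose F (ki : 'I_m * 'I_d) : pred int :=
  if ki.1 == i then [pred z : int | z%:~R == x 0 ki.2] else predT.
apply: (@le_trans _ _ (box_freq R b n (fun v => [forall ki, F ki (v ki)]))).
  apply: box_freq_le => v _ /eqP e; apply/forallP => -[k j]; rewrite /F /=.
  case: eqP => //= ->; move/rowP: e => /(_ j); rewrite !mxE /mix /= eqxx => ->.
  apply/eqP; apply: eq_bigr => k' _; rewrite !mxE /= eq_sym.
  by rewrite (negbTE (neq_lift _ _)).
rewrite (box_freq_forall R b n F).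
pose G (k : 'I_m) (j : 'I_d) : R := if k == i then 2 / p%:R else 1.
apply: (@le_trans _ _ (\prod_(ki : 'I_m * 'I_d) G ki.1 ki.2)).
  apply: ler_prod => -[k j] _; rewrite divr_ge0//= /F /G /=; case: eqP => _.
    rewrite ler_pdivrMr ?ltr0n// mulrAC ler_pdivlMr ?ltr0n// -!natrM ler_nat.
    apply: (@leq_trans ((n %/ p).+1 * p)).
      by rewrite leq_mul2r; apply/orP; right; exact: card_Fp_residue_le.
    by have := divn_eq n p; nia.
  rewrite ler_pdivrMr ?ltr0n// mul1r ler_nat.
  by rewrite -[leqRHS]card_ord max_card.
rewrite -(pair_bigA _ G) /= (bigD1 i) //= [X in _ * X]big1 => [|k ki].
  by rewrite mulr1 /G eqxx prodr_const card_ord.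
by rewrite /G (negbTE ki) big1.
Qed.

(** A union bound over the dependent row and its [p^(m-1)] coefficient vectors gives
    [m p^(m-1) (2/p)^d], and [m + 1 <= d] leaves the factor [p^-2]. *)
Lemma box_freq_rank_deficient (b : 'I_m * 'I_d -> int) n p :
  prime p -> (p <= n)%N ->
  box_freq R b n (fun u => ~~ full_rank p u) <= (m * 2 ^ d)%:R * (p%:R ^+ 2)^-1.
Proof.
move=> pp pn.
pose X (ic : 'I_m * 'rV['F_p]_m.-1) (u : 'I_m * 'I_d -> int) :=
  let M := map_mx (intr : int -> 'F_p) (mx_of u) in row ic.1 M == ic.2 *m row' ic.1 M.
apply: (@le_trans _ _ (box_freq R b n [pred u | [exists ic in (xpredT : pred _), X ic u]])).
  apply: box_freq_le => u _ /row_freePn[i /submxP[c ic]].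
  by apply/existsP; exists (i, c); rewrite /= /X /=; apply/eqP.
apply: le_trans (box_freq_exists R b n (xpredT : pred _) X) _.
apply: (@le_trans _ _ (\sum_(ic : 'I_m * 'rV['F_p]_m.-1) (2 / p%:R) ^+ d)).
  by apply: ler_sum => -[i c] _; exact: box_freq_row_combination.
have p0 : 0 < p%:R :> R by rewrite ltr0n prime_gt0.
rewrite sumr_const card_prod card_mx card_Fp// card_ord mul1n -[leLHS]mulr_natr.
rewrite expr_div_n mulrAC ler_pdivrMr ?exprn_gt0//.
rewrite mulrAC ler_pdivlMr ?exprn_gt0// -!natrX -!natrM ler_nat.
rewrite [(2 ^ d * _)%N]mulnC -!mulnA [(p ^ m.-1 * _)%N]mulnCA leq_mul2l.
(* For [m = 0] the truncated [m.-1] spoils the comparison of exponents, but then the common factor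
   [m] vanishes. *)
apply/orP; have [->|m0] := posnP m; [by left|right].
rewrite leq_mul2l -expnD leq_pexp2l ?orbT ?prime_gt0//; lia.
Qed.

Lemma box_freq_middle_primes (b : 'I_m * 'I_d -> int) M n :
  (0 < M)%N -> (M <= n)%N ->
  box_freq R b n (fun u => has (fun p => ~~ full_rank p u)
     [seq p <- index_iota M.+1 n.+1 | prime p]) <= (m * 2 ^ d)%:R / M%:R.
Proof.
move=> M0 Mn.
apply: le_trans (box_freq_has R b n _ (fun p u => ~~ full_rank p u)) _.
rewrite big_filter big_nat_cond.
apply: (@le_trans _ _ (\sum_(M.+1 <= p < n.+1) (m * 2 ^ d)%:R * (p%:R ^+ 2)^-1)).
  rewrite big_mkcond [leRHS]big_nat_cond [leRHS]big_mkcond /=.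
  apply: ler_sum => p _; rewrite andbT; case: (boolP (M < p < n.+1)%N) => //= Mpn.
  case: ifP => pp; last by rewrite mulr_ge0 ?invr_ge0 ?exprn_ge0.
  by apply: box_freq_rank_deficient => //; lia.
rewrite -mulr_sumr ler_wpM2l//; apply: le_trans (tail_sum_le _ _ M0 Mn) _ => //.
by rewrite lerBlDr lerDl.
Qed.

End MiddlePrimes.

(** * Primes larger than n *)

Lemma prod_primes_dvdn ps D : uniq ps -> all prime ps ->
  all (fun p => p %| D)%N ps -> (\prod_(p <- ps) p %| D)%N.
Proof.
elim: ps => [|p ps IH] /=; first by rewrite big_nil dvd1n.
move=> /andP[pps ups] /andP[pp aps] /andP[pD psD].
by rewrite big_cons Gauss_dvd ?coprime_prod_primes// pD IH.
Qed.

(** The product of distinct primes dividing [D] divides [D], so having [k] of them above [n] forces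
    [n ^ k <= D]. *)
Lemma size_large_primes n D t : (1 < n)%N -> (0 < D)%N -> (D < n ^ t.+1)%N ->
  (size [seq p <- primes D | n < p] <= t)%N.
Proof.
move=> n1 D0 Dt; set ps := [seq _ <- _ | _].
have sub p : p \in ps -> [/\ prime p, (p %| D)%N & (n < p)%N].
  by rewrite mem_filter mem_primes => /andP[-> /and3P[-> _ ->]].
have : (\prod_(p <- ps) p <= D)%N.
  apply: dvdn_leq => //; apply: prod_primes_dvdn.
  - exact/filter_uniq/primes_uniq.
  - by apply/allP => p /sub[].
  - by apply/allP => p /sub[].
have : (n ^ size ps <= \prod_(p <- ps) p)%N.
  elim: (ps) sub => [|p qs IH] sub; first by rewrite big_nil.
  rewrite big_cons /= expnS leq_mul//.
    by have [_ _ /ltnW] := sub p (mem_head _ _).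
  by apply: IH => q qqs; apply: sub; rewrite inE qqs orbT.
move=> /leq_trans h /h /leq_ltn_trans /(_ Dt); rewrite ltn_exp2l//.
Qed.

Lemma card_has_le (T : finType) (C : Type) (s : seq C) (X : C -> pred T) :
  (#|[pred x | has (X^~ x) s]| <= \sum_(c <- s) #|X c|)%N.
Proof.
elim: s => [|c s IH]; first by rewrite big_nil leqn0; apply/eqP/eq_card0.
rewrite big_cons; apply: leq_trans (leq_add (leqnn _) IH).
rewrite -cardUI; apply: leq_trans (leq_addr _ _).
by apply: subset_leq_card; apply/fintype.subsetP => x; rewrite !inE.
Qed.

Lemma abs_det_le r (A : 'M[int]_r) (B : int) :
  (forall i j, `|A i j| <= B) -> `|\det A| <= r`!%:Z * B ^+ r.
Proof.
move=> AB; apply: le_trans (ler_norm_sum _ _ _) _.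
apply: (@le_trans _ _ (\sum_(s : {perm 'I_r}) B ^+ r)).
  apply: ler_sum => s _; rewrite normrM normrX normrN1 expr1n mul1r normr_prod.
  apply: (@le_trans _ _ (\prod_(i < r) B)); first by apply: ler_prod => i _; rewrite normr_ge0 AB.
  by rewrite prodr_const card_ord.
by rewrite sumr_const card_Sn -[leLHS]mulr_natl natz.
Qed.

(** Expand along the last row: its cofactors do not involve that row, so they agree for [A] and [B],
    and only the corner term changes. *)
Lemma det_corner (F : comPzRingType) r (A B : 'M[F]_r.+1) :
  (forall i j, (i, j) != (ord_max, ord_max) -> A i j = B i j) ->
  \det A - \det B = (A ord_max ord_max - B ord_max ord_max) *
    \det (\matrix_(i < r, j < r) A (widen_ord (leqnSn r) i) (widen_ord (leqnSn r) j)).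
Proof.
move=> AB.
have liftE (i : 'I_r) : lift ord_max i = widen_ord (leqnSn r) i.
  by apply: val_inj; rewrite /= /bump leqNgt ltn_ord.
have cof j : cofactor A ord_max j = cofactor B ord_max j.
  rewrite /cofactor; congr (_ * \det _); apply/matrixP => i k; rewrite !mxE.
  by rewrite AB// xpair_eqE negb_and eq_sym neq_lift.
rewrite !(expand_det_row _ ord_max) -sumrB big_ord_recr /= big1 => [|j _].
  rewrite add0r -cof -mulrBl; congr (_ * _).
  rewrite /cofactor -signr_odd addnn odd_double expr0 mul1r.
  by congr (\det _); apply/matrixP => i j; rewrite !mxE !liftE.
rewrite AB ?cof ?subrr// xpair_eqE negb_and orbC.
by rewrite -(inj_eq val_inj) /= ltn_eqF.
Qed.

(** * Rank of matrices that differ only in the corner entry *)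

Section Corner.
Variables (F : fieldType) (r c : nat).
Implicit Types A B : 'M[F]_(r.+1, c.+1).

Definition top_left A : 'M[F]_(r, c) :=
  \matrix_(i < r, j < c) A (widen_ord (leqnSn r) i) (widen_ord (leqnSn c) j).

(** When the last coordinate vanishes, the other ones form a relation between the rows of
    [top_left A]. Hence a vector annihilating all columns but the last is determined by its last
    coordinate. *)
Lemma row_free_top_left A (v : 'rV_r.+1) : row_free (top_left A) ->
  (forall j : 'I_c, (v *m A) 0 (widen_ord (leqnSn c) j) = 0) ->
  v 0 ord_max = 0 -> v = 0.
Proof.
move=> frA vA vmax.
have w0 : \row_(i < r) v 0 (widen_ord (leqnSn r) i) = 0.
  apply: (row_free_inj frA); rewrite mul0mx; apply/rowP => j.
  rewrite [RHS]mxE -(vA j) mxE [RHS]mxE big_ord_recr /= vmax mul0r addr0.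
  by apply: eq_bigr => i _; rewrite !mxE.
apply/rowP => i; rewrite mxE; have [ir|] := ltnP i r.
  have /rowP/(_ (Ordinal ir)) := w0; rewrite !mxE => <-.
  by congr (v 0 _); apply: val_inj.
by move=> ri; rewrite -vmax; congr (v 0 _); apply: val_inj => /=; have := ltn_ord i; lia.
Qed.

(* A kernel vector is determined by its last entry, which is nonzero, so the
   relation it gives in the last column determines the corner entry. *)
Lemma not_row_free_corner A B :
  (forall i j, (i, j) != (ord_max, ord_max) -> A i j = B i j) ->
  row_free (top_left A) -> ~~ row_free A -> ~~ row_free B ->
  A ord_max ord_max = B ord_max ord_max.
Proof.
move=> AB frA nA nB.
have ABw i j : A i (widen_ord (leqnSn c) j) = B i (widen_ord (leqnSn c) j).
  by rewrite AB// xpair_eqE negb_and orbC -(inj_eq val_inj) /= ltn_eqF.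
have frB : row_free (top_left B).
  congr (is_true (row_free _)): frA; apply/matrixP => i j; rewrite !mxE; exact: ABw.
have ker (M : 'M[F]_(r.+1, c.+1)) : row_free (top_left M) -> ~~ row_free M ->
    exists2 x : 'rV_r.+1, x 0 ord_max = 1 & x *m M = 0.
  move=> frM; rewrite -kermx_eq0 => /rowV0Pn[v /sub_kermxP vM v0].
  have vmax : v 0 ord_max != 0.
    apply: contraNneq v0 => vmax; apply/eqP; apply: row_free_top_left frM _ vmax.
    by move=> j; rewrite vM mxE.
  exists ((v 0 ord_max)^-1 *: v); first by rewrite mxE mulVf.
  by rewrite -scalemxAl vM scaler0.
have [x x1 xA] := ker A frA nA; have [y y1 yB] := ker B frB nB.
have xy : x - y = 0.
  apply: (row_free_top_left frA) => [j|]; last by rewrite !mxE x1 y1 subrr.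
  set j' := widen_ord _ j; have e : (y *m A) 0 j' = (y *m B) 0 j'.
    by rewrite !mxE; apply: eq_bigr => i _; rewrite ABw.
  by rewrite mulmxBl xA sub0r mxE e yB mxE oppr0.
move/eqP: xy; rewrite subr_eq0 => /eqP xy.
pose w := widen_ord (leqnSn r).
have eA : \sum_(i < r) x 0 (w i) * A (w i) ord_max + A ord_max ord_max = 0.
  by have /rowP/(_ ord_max) := xA; rewrite !mxE big_ord_recr /= x1 mul1r.
have eB : \sum_(i < r) x 0 (w i) * B (w i) ord_max + B ord_max ord_max = 0.
  by have /rowP/(_ ord_max) := yB; rewrite !mxE big_ord_recr /= -xy x1 mul1r.
apply: (addrI (\sum_(i < r) x 0 (w i) * B (w i) ord_max)); rewrite eB -[RHS]eA.
congr (_ + _); apply: eq_bigr => i _; rewrite AB// xpair_eqE negb_and.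
by rewrite -(inj_eq val_inj) /= ltn_eqF.
Qed.

End Corner.

Lemma row_free_colsub (F : fieldType) m n n' (f : 'I_n' -> 'I_n) (A : 'M[F]_(m, n)) :
  row_free (colsub f A) -> row_free A.
Proof.
move=> frA; apply: inj_row_free => v vA; apply: (row_free_inj frA).
rewrite mul0mx; apply/rowP => j; have /rowP/(_ (f j)) := vA.
by rewrite !mxE => vAj; rewrite -[RHS]vAj; apply: eq_bigr => i _; rewrite mxE.
Qed.

(** * Leading blocks of a random matrix modulo large primes *)

Section LargePrimes.
Variables (R : realType) (m d : nat).
Implicit Types u v : 'I_m * 'I_d -> int.

(** Natural-number indices with default 0 let the induction on the block size proceed without bound
    proofs in the types. *)
Definition entry u (k i : nat) : int :=
  match insub k, insub i with
  | Some k', Some i' => u (k', i')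
  | _, _ => 0
  end.

Definition corner r c u : 'M[int]_(r, c) := \matrix_(k < r, i < c) entry u k i.

Lemma entryE u (k : 'I_m) (i : 'I_d) : entry u k i = u (k, i).
Proof. by rewrite /entry !valK. Qed.

Lemma entry_mix1 (k0 : 'I_m) (i0 : 'I_d) u v k i :
  entry (mix (pred1 (k0, i0)) u v) k i =
  if (k == k0 :> nat) && (i == i0 :> nat) then v (k0, i0) else entry u k i.
Proof.
case: ifP => [/andP[/eqP -> /eqP ->]|H]; first by rewrite entryE /mix /= eqxx.
rewrite /entry; case: insubP => // k' _ kE; case: insubP => // i' _ iE.
by rewrite /mix /= xpair_eqE -!(inj_eq val_inj) /= kE iE H.
Qed.

Lemma corner_mix1 (k0 : 'I_m) (i0 : 'I_d) u v r c : (r <= k0)%N || (c <= i0)%N ->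
  corner r c (mix (pred1 (k0, i0)) u v) = corner r c u.
Proof.
move=> rc; apply/matrixP => k i; rewrite !mxE entry_mix1.
by have := ltn_ord k; have := ltn_ord i; case: ifP => // /andP[/eqP -> /eqP ->]; lia.
Qed.

Definition singular r u : bool := \det (corner r r u) == 0.

(** The quantifier over [p] lies inside the event: infinitely many primes exceed [n], and a bound of
    order [1/n] for each could not be summed. *)
Definition deficient n r c u : bool := `[< exists p, [/\ prime p, (n < p)%N &
  ~~ row_free (map_mx (intr : int -> 'F_p) (corner r c u))] >].

Variables (b : 'I_m * 'I_d -> int) (n : nat).
Hypotheses (m_lt_d : (m < d)%N) (n_gt1 : (1 < n)%N).
Let n_gt0 : (0 < n)%N := ltnW n_gt1.

(** The empty minor is 1. If the minor of order [r] is nonzero, it is the slope of the next one as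
    an affine function of the entry [(r, r)], so at most one of [n] values is a root and each step
    costs [1/n]. *)
Lemma box_freq_singular r : (r <= m)%N ->
  box_freq R b n (singular r) <= r%:R / n%:R.
Proof.
elim: r => [_|r IH rm].
  rewrite mul0r (_ : singular 0 = pred0) ?box_freq0//.
  by apply/funext => u; rewrite /singular det_mx00 oner_eq0.
pose X u := ~~ singular r u && singular r.+1 u.
apply: (@le_trans _ _ (box_freq R b n [pred u | singular r u || X u])).
  by apply: box_freq_le => u _ /= s; rewrite /X s andbT orbN.
apply: le_trans (box_freqU _ _ _ _ _) _; rewrite -(addn1 r) natrD mulrDl.
apply: lerD; first exact: IH (ltnW rm).
have rd : (r < d)%N by rewrite (leq_trans rm)// ltnW.
pose ki := (Ordinal rm, Ordinal rd).
apply: (@box_freq_mix1 _ _ _ _ ki) => // u _.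
have cE v : corner r r (mix (pred1 ki) u v) = corner r r u.
  by rewrite corner_mix1 ?leqnn.
apply/card_le1_eqP => t1 t2; rewrite !inE /X => /andP[n1 s1] /andP[_ s2].
move: n1 s1 s2; rewrite /singular !cE.
set A0 := corner _ _ _; set A1 := corner _ _ _; set A2 := corner _ _ _ => n1 /eqP s1 /eqP s2.
have A21 (i j : 'I_r.+1) : (i, j) != (ord_max, ord_max) -> A2 i j = A1 i j.
  rewrite !mxE !entry_mix1 xpair_eqE -!(inj_eq val_inj) /=.
  by move/negbTE => ->.
have /eqP := det_corner A21; rewrite s1 s2 subrr eq_sym mulf_eq0.
rewrite !mxE !entry_mix1 /= !eqxx /=.
set D := \det _; have -> : D = \det (corner r r u).
  congr (\det _); apply/matrixP => i j; rewrite !mxE entry_mix1 /=.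
  by rewrite ltn_eqF.
by rewrite (negbTE n1) orbF => ?; apply: val_inj => /=; lia.
Qed.

Variable t : nat.
Hypothesis det_lt : forall u r, in_box b n u -> (r <= m)%N ->
  (`|\det (corner r r u)| < n ^ t.+1)%N.

(** Passing from [r] to [r + 1] costs [(r + 1)/n <= m/n] for a vanishing minor of order [r + 1], and
    [t/n] for the at most [t] large primes dividing it otherwise, each with at most one bad value of
    the entry [(r, r + 1)]. *)
Lemma box_freq_deficient r : (r <= m)%N ->
  box_freq R b n (deficient n r r.+1) <= (r * (m + t))%:R / n%:R.
Proof.
elim: r => [_|r IH rm].
  rewrite mul0n mul0r (_ : deficient n 0 1 = pred0) ?box_freq0//.
  apply/funext => u; apply/asboolPn => -[p [_ _]].
  by rewrite -row_leq_rank.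
have rd : (r.+1 < d)%N by rewrite (leq_trans _ m_lt_d).
pose X u := [&& ~~ deficient n r r.+1 u, ~~ singular r.+1 u & deficient n r.+1 r.+2 u].
apply: (@le_trans _ _ (box_freq R b n
   [pred u | deficient n r r.+1 u || [pred u | singular r.+1 u || X u] u])).
  apply: box_freq_le => u _ /= s; rewrite /X s.
  by do 2 case: (X in X || _) => //=.
apply: le_trans (box_freqU _ _ _ _ _) _.
apply: (@le_trans _ _ ((r * (m + t))%:R / n%:R + (r.+1%:R / n%:R + t%:R / n%:R))).
  apply: lerD; first exact: IH (ltnW rm).
  apply: le_trans (box_freqU _ _ _ _ _) _; apply: lerD; first exact: box_freq_singular.
  apply: (@box_freq_mix1 _ _ _ _ (Ordinal rm, Ordinal rd)) => // u ub.
  (* Varying the entry [(r, r + 1)] changes neither block in [c1] and [c2], so the first two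
     conditions of [X] can be decided before it is chosen. *)
  pose ut (s : 'I_n) := mix (pred1 (Ordinal rm, Ordinal rd)) u (fun i => b i + s%:Z).
  have c1 s : corner r r.+1 (ut s) = corner r r.+1 u by rewrite corner_mix1 ?leqnn.
  have c2 s : corner r.+1 r.+1 (ut s) = corner r.+1 r.+1 u.
    by rewrite corner_mix1 ?leqnn ?orbT.
  have [/asboolP nd|d1] := boolP (~~ deficient n r r.+1 u); last first.
    rewrite eq_card0// => s; rewrite !inE -/(ut s) /X /deficient c1.
    by rewrite -/(deficient n r r.+1 u) (negbTE d1).
  have [ns|s1] := boolP (~~ singular r.+1 u); last first.
    rewrite eq_card0// => s; rewrite !inE -/(ut s) /X /singular c2.
    by rewrite -/(singular r.+1 u) (negbTE s1) andbF.
  pose D := `|\det (corner r.+1 r.+1 u)|%N.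
  pose Y p s := ~~ row_free (map_mx (intr : int -> 'F_p) (corner r.+1 r.+2 (ut s))).
  pose ps := [seq p <- primes D | (n < p)%N].
  have D0 : (0 < D)%N by rewrite absz_gt0.
  (* If [p] does not divide [D], the square block is invertible modulo [p] and the wider block has
     full rank; so only primes in [ps] can fail. *)
  apply: (@leq_trans #|[pred s | has (Y^~ s) ps]|).
    apply: subset_leq_card; apply/fintype.subsetP => s; rewrite !inE -/(ut s).
    move=> /and3P[_ _ /asboolP[p [pp np nf]]].
    apply/hasP; exists p => //; rewrite mem_filter np mem_primes pp D0 /=.
    apply: contraNT nf => pD; pose w (i : 'I_r.+1) := widen_ord (leqnSn r.+1) i.
    apply: (@row_free_colsub _ _ _ _ w).
    have -> : colsub w (map_mx (intr : int -> 'F_p) (corner r.+1 r.+2 (ut s))) =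
        map_mx intr (corner r.+1 r.+1 (ut s)).
      by apply/matrixP => i j; rewrite !mxE.
    rewrite c2 row_free_unit unitmxE unitfE det_map_mx.
    by rewrite -(dvdz_pcharf (pchar_Fp pp)) dvdzE.
  apply: leq_trans (card_has_le _ _) _.
  apply: (@leq_trans (\sum_(p <- ps) 1)); last first.
    rewrite sum1_size; apply: size_large_primes => //; exact: det_lt.
  rewrite big_seq [leqRHS]big_seq; apply: leq_sum => p; rewrite mem_filter mem_primes.
  move=> /andP[np /andP[pp _]].
  (* Two bad values are congruent modulo [p] by [not_row_free_corner], hence equal, as the offsets
     are below [n < p]. *)
  apply/card_le1_eqP => s1 s2 s1Y s2Y.
  have f1 : Y p s1 := s1Y; have f2 : Y p s2 := s2Y.
  have := not_row_free_corner _ _ f1 f2; rewrite !mxE !entry_mix1 /= !eqxx /= => H.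
  have : (b (Ordinal rm, Ordinal rd) + s1%:Z)%:~R =
         (b (Ordinal rm, Ordinal rd) + s2%:Z)%:~R :> 'F_p.
    apply: H => [i j|].
      rewrite !mxE !entry_mix1 xpair_eqE -!(inj_eq val_inj) /=.
      by move/negbTE => ->.
    rewrite (_ : top_left _ = map_mx intr (corner r r.+1 u)).
      by apply: contra_notT nd => nf; exists p.
    by rewrite -(c1 s1); apply/matrixP => i j; rewrite !mxE.
  rewrite !rmorphD /= => /addrI; rewrite -!pmulrn => /(congr1 val).
  rewrite /= !val_Fp_nat// !modn_small ?(ltn_trans (ltn_ord _))// => e.
  exact: val_inj.
rewrite -!mulrDl ler_wpM2r ?invr_ge0// -!natrD ler_nat.
by rewrite mulSn; lia.
Qed.

(** For [r = m] the block consists of the first [m + 1] columns, available since [m < d]; if it has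
    full rank, so does the whole matrix. *)
Lemma box_freq_large_primes :
  box_freq R b n (fun u => `[< exists p, [/\ prime p, (n < p)%N & ~~ full_rank p u] >])
  <= (m * (m + t))%:R / n%:R.
Proof.
apply: le_trans (box_freq_deficient (leqnn m)); apply: box_freq_le => u _.
move=> /asboolP[p [pp np nf]]; apply/asboolP; exists p; split=> //.
apply: contra nf => frc; pose w (i : 'I_m.+1) := widen_ord m_lt_d i.
apply: (@row_free_colsub _ _ _ _ w); congr (is_true (row_free _)): frc.
apply/matrixP => k i; rewrite !mxE -entryE; congr ((entry _ _ _)%:~R).
Qed.

End LargePrimes.

(** * From probability to frequency *)

Section UniformBox.
Variables (dT : measure_display) (T : measurableType dT) (R : realType).
Variables (P : probability T R) (I : finType) (X : I -> {RV P >-> int}).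
Variables (b : I -> int) (n : nat).
Hypothesis n_gt0 : (0 < n)%N.
Hypothesis X_indep : mutually_independent X.
Hypothesis X_unif : forall i, uniform_int (X i) (b i) n.

Let fiber (u : I -> int) : set T := \bigcap_i (X i @^-1` [set u i]).

Let measurable_fiber u : measurable (fiber u).
Proof.
apply: fin_bigcap_measurable => [|i _]; first exact: finite_finset.
exact: measurable_funPTI.
Qed.

Let fiberE u w : fiber u w <-> (fun i => X i w) = u.
Proof. by split=> [H|<- i _//]; apply/funext => i; exact: H. Qed.

Let prob_fiber (x : {ffun I -> 'I_n}) :
  P (fiber (box_point b x)) = ((n ^ #|I|)%:R^-1)%:E.
Proof.
have := X_indep [set: I]%SET (B := fun i => [set box_point b x i]) (fun _ => Logic.I).
rewrite (_ : [set` [set: I]%SET] = [set: I]); last first.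
  by apply/seteqP; split=> i _ //=; rewrite inE.
move=> ->; rewrite (eq_bigr (fun=> (n%:R^-1)%:E)); last first.
  move=> i _; have := X_unif i (box_point b x i).
  by rewrite box_point_in /distribution /pushforward.
rewrite prodEFin; congr (_%:E).
by rewrite prodr_const cardsT natrX exprVn.
Qed.

Let prob_fibers (Y : pred (I -> int)) :
  P (\bigcup_(x in [set` [pred x : {ffun I -> 'I_n} | Y (box_point b x)]])
       fiber (box_point b x)) = (box_freq R b n Y)%:E.
Proof.
rewrite measure_fin_bigcup; last 3 first.
- exact: finite_finset.
- move=> x y _ _ [w [/fiberE xw /fiberE e]]; rewrite xw in e; apply/ffunP => i; apply: val_inj.
  by have := congr1 (@^~ i) e; rewrite /box_point /= => /addrI [].
- by move=> x _.
rewrite -(@bigfs _ _ _ _ (index_enum {ffun I -> 'I_n})) ?index_enum_uniq//; last first.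
  by move=> x _; rewrite mem_index_enum.
rewrite (eq_bigr (fun=> ((n ^ #|I|)%:R^-1)%:E)); last by move=> x _; exact: prob_fiber.
rewrite sumEFin sumr_const /box_freq; congr (_%:E).
by rewrite -[LHS]mulr_natl.
Qed.

Lemma prob_box_freq (Y : pred (I -> int)) :
  P [set w | Y (fun i => X i w)] = (box_freq R b n Y)%:E.
Proof.
set E := [set w | _].
(* Integer vectors are countable, so [E] is a countable union of fibers. *)
have mE : measurable E.
  rewrite (_ : E = \bigcup_(u : {ffun I -> int})
      (if Y u then fiber u else set0)).
    apply: countable_bigcupT_measurable => [|u]; first exact: countableP.
    by case: ifP.
  apply/seteqP; split=> w /=.
    move=> Ew; exists [ffun i => X i w] => //.
    have e : ([ffun i => X i w] : I -> int) = (fun i => X i w).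
      by apply/funext => i; rewrite ffunE.
    by rewrite e ifT//; apply/fiberE.
  by move=> [u _]; case: ifP => // Yu /fiberE; rewrite /E /= => ->.
(* [U] is the event that the variables land in the box; it has probability 1, so only the finitely
   many fibers inside it count. *)
set U := \bigcup_(x in [set` [pred x : {ffun I -> 'I_n} | predT (box_point b x)]])
  fiber (box_point b x).
have mU : measurable U.
  by apply: fin_bigcup_measurable => [|x _]; first exact: finite_finset.
have PU : P U = 1%E by rewrite prob_fibers box_freqT.
have PCU : P (~` U) = 0%E by rewrite probability_setC// PU subee.
rewrite (measureDI _ mE mU) (@subset_measure0 _ _ _ P _ (~` U)).
- rewrite -prob_fibers add0e; congr (P _); apply/seteqP; split=> w.
    by move=> [Ew [x _ xw]]; exists x => //; move: Ew; rewrite /E /= (iffLR (fiberE _ _) xw).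
  move=> [x /= Yx xw]; split; last by exists x.
  by rewrite /E /= (iffLR (fiberE _ _) xw).
- exact: measurableD.
- exact: measurableC.
- by move=> w [].
- exact: PCU.
Qed.

End UniformBox.

(** * Convergence *)

(** With [C] the sum of the absolute values of the coefficients, [f(n) <= C n^(size f)] for
    [n >= 1], and one more factor [n] absorbs [C]. *)
Lemma horner_le_exp (R : realType) (f : {poly R}) :
  exists K N, forall n, (N <= n)%N -> f.[n%:R] <= n%:R ^+ K.
Proof.
pose C := \sum_(i < size f) `|f`_i|.
have C0 : 0 <= C by apply: sumr_ge0 => i _; exact: normr_ge0.
exists (size f).+1, (Num.bound C).+1 => n Nn.
have n1 : 1 <= n%:R :> R by rewrite ler1n; lia.
have Cn : C <= n%:R.
  by apply: le_trans (ltW (archi_boundP C0)) _; rewrite ler_nat; lia.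
rewrite horner_coef exprS; apply: (@le_trans _ _ (C * n%:R ^+ size f)).
  rewrite mulr_suml; apply: ler_sum => i _; apply: le_trans (ler_norm _) _.
  rewrite normrM normrX normr_nat; apply: ler_wpM2l => //.
  by rewrite ler_weXn2l// ltnW.
by rewrite ler_wpM2r// exprn_ge0.
Qed.

(** First [M] is fixed so that [a M] and [e1 M] are within [e / 4] of their limits, then [n] grows;
    the four errors add up to at most [e]. *)
Lemma cvg_sandwich (R : realType) (g a e1 e2 : nat -> R) (A : nat -> nat -> R) (l : R) :
  (forall M, A M n @[n --> \oo] --> a M) -> a M @[M --> \oo] --> l ->
  e1 M @[M --> \oo] --> (0 : R) -> e2 n @[n --> \oo] --> (0 : R) ->
  (forall M, \forall n \near \oo, A M n - e1 M - e2 n <= g n <= A M n) ->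
  g n @[n --> \oo] --> l.
Proof.
move=> cA /cvgrPdist_le ca /cvgrPdist_le c1 /cvgrPdist_le c2 H.
apply/cvgrPdist_le => e e0; have e4 : 0 < e / 4 by rewrite divr_gt0.
have [M [aM eM]] : exists M, `|l - a M| <= e / 4 /\ `|0 - e1 M| <= e / 4.
  have [M0 _ HM] := ca _ e4; have [M1 _ HM'] := c1 _ e4.
  by exists (maxn M0 M1); split; [apply: HM|apply: HM']; rewrite /= ?leq_maxl ?leq_maxr.
have /cvgrPdist_le/(_ _ e4) cM := cA M.
have c2' := c2 _ e4; have HM := H M.
near=> n.
have /andP[h1 h2] : A M n - e1 M - e2 n <= g n <= A M n by near: n.
have h3 : `|a M - A M n| <= e / 4 by near: n.
have h4 : `|0 - e2 n| <= e / 4 by near: n.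
move: aM eM h3 h4; rewrite !ler_norml => /andP[? ?] /andP[? ?] /andP[? ?] /andP[? ?].
by apply/andP; split; lra.
Unshelve. all: by end_near. Qed.

(** The Leibniz formula gives [r! n^(K r) <= n n^(K m)], and a further factor [n > 1] makes the
    inequality strict. *)
Lemma abs_det_corner_lt (m d n K : nat) (u : 'I_m * 'I_d -> int) r :
  (1 < n)%N -> (m`! <= n)%N -> (forall ki, `|u ki| <= (n ^ K)%N%:Z) -> (r <= m)%N ->
  (`|\det (corner r r u)| < n ^ (K * m).+2)%N.
Proof.
move=> n1 mn uK rm; have n0 : (0 < n)%N by lia.
have := @abs_det_le r (corner r r u) (n ^ K)%N%:Z.
have H i j : `|corner r r u i j| <= (n ^ K)%N%:Z.
  by rewrite mxE /entry; do 2 case: insub => [?|] //; rewrite normr0.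
move=> /(_ H); rewrite -ltz_nat abszE => /le_lt_trans; apply.
rewrite -!natz -natrX -natrM !natz ltz_nat -expnM expnS.
apply: (@leq_ltn_trans (n * n ^ (K * m))).
  by rewrite leq_mul ?(leq_trans (leq_fact rm))// leq_exp2l// leq_mul2l rm orbT.
by rewrite ltn_pmul2l// expnS ltn_Pmull// expn_gt0 n0.
Qed.

Theorem theorem1 (R : realType) (d m : nat) (m_gt0 : (0 < m)%N) (m_lt_d : (m < d)%N)
    (b : nat -> 'I_m -> 'I_d -> int)
    (b_poly : exists f : {poly R}, forall (n : nat) (k : 'I_m) (i : 'I_d),
       (0 < n)%N -> `|(b n k i)%:~R : R| <= f.[n%:R])
    (disp : nat -> measure_display)
    (T : forall n : nat, measurableType (disp n))
    (P : forall n : nat, probability (T n) R)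
    (s : forall n : nat, 'I_m -> 'I_d -> {RV (P n) >-> int})
    (s_indep : forall n : nat, (0 < n)%N ->
       mutually_independent (fun ki : 'I_m * 'I_d => s n ki.1 ki.2))
    (s_unif : forall (n : nat) (k : 'I_m) (i : 'I_d), (0 < n)%N ->
       uniform_int (s n k i) (b n k i) n) :
  P n [set w : T n | primitive R (\matrix_(k < m, i < d) s n k i w)]
    @[n --> \oo] -->
  ((\prod_(j < m) zeta ((d - j)%N%:R : R))^-1)%:E.
Proof.
pose b' n (ki : 'I_m * 'I_d) := b n ki.1 ki.2.
pose Y u : bool := `[< primitive R (@mx_of m d u) >].
pose g n := box_freq R (b' n) n Y.
(* The index is [n.+1] because the variables are only assumed independent and uniform for positive
   [n]; the shift does not affect the limit. *)
have PE n : P n.+1 [set w | primitive R (\matrix_(k < m, i < d) s n.+1 k i w)] =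
    (g n.+1)%:E.
  rewrite -(prob_box_freq (X := fun ki : 'I_m * 'I_d => s n.+1 ki.1 ki.2))//.
  - by congr (P n.+1 _); apply/seteqP; split=> w; rewrite /Y /= => /asboolP.
  - exact: s_indep.
  - by move=> ki; exact: s_unif.
suff gl : g n @[n --> \oo] --> (\prod_(j < m) zeta ((d - j)%N%:R : R))^-1.
  rewrite -cvg_shiftS /=; under eq_fun do rewrite PE.
  apply: cvg_EFin; first by near=> n.
  by rewrite -cvg_shiftS in gl; exact: gl.
have [K [N0 bK]] : exists K N, forall n, (N <= n)%N ->
    forall u, in_box (b' n) n u -> forall ki, `|u ki| <= (n ^ K)%N%:Z.
  have [f fb] := b_poly; have [K [N fK]] := horner_le_exp f.
  (* A point of the box exceeds [|b| <= n^K] by at most [n], and [n^K + n <= n^(K+2)]. *)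
  exists K.+2, N.+2 => n Nn u ub ki.
  have bn : `|b' n ki| <= (n ^ K)%N%:Z.
    rewrite -(ler_int R) intr_norm; apply: le_trans (fb n ki.1 ki.2 _) _; first by lia.
    by rewrite -pmulrn natrX fK//; lia.
  have n2 : (n ^ K + n <= n ^ K.+2)%N.
    have : (0 < n ^ K)%N by rewrite expn_gt0; lia.
    rewrite !expnS; move: (n ^ K)%N => x x0.
    have xn : (x + n <= n * x + 1)%N by nia.
    by apply: leq_trans xn _; nia.
  by have := ub ki; move: bn n2; move: (n ^ K)%N (n ^ K.+2)%N (b' n ki) (u ki); lia.
(* With this [t], the bound of [abs_det_corner_lt] is [n ^ t.+1]. *)
pose t := (K * m).+1; pose C : R := (m * 2 ^ d)%:R; pose C' : R := (m * (m + t))%:R.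
have cC (c : R) : c * harmonic n @[n --> \oo] --> (0 : R).
  by rewrite -[X in _ --> X](mulr0 c); apply: cvgMr; exact: cvg_harmonic.
(* The cutoff between small and middle primes is [M.+1], so that it is positive and its inverse is
   [harmonic M]. *)
apply: (@cvg_sandwich R g
  (fun M => \prod_(j < m) \prod_(p <- primes_upto M.+1) (1 - (p%:R ^+ (d - j))^-1))
  (fun M => C * harmonic M) (fun n => C' / n%:R)
  (fun M n => box_freq R (b' n) n
     (fun u => all (@full_rank m d ^~ u) (primes_upto M.+1)))).
- by move=> M; apply: box_freq_small_primes_cvg; exact: ltnW.
- rewrite -prodfV; apply: cvg_big => [|j _]; first exact: mul_continuous.
  have := @euler_product_cvg R (d - j); rewrite -cvg_shiftS; apply.
  by have := ltn_ord j; lia.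
- exact: cC.
- by rewrite -cvg_shiftS; exact: cC.
move=> M; near=> n.
have Mn : (M < n)%N by near: n; exists M.+1.
have n1 : (1 < n)%N by near: n; exists 2%N.
have mn : (m`! <= n)%N by near: n; exists m`!.
have Nn : (N0 <= n)%N by near: n; exists N0.
apply/andP; split; last first.
  apply: box_freq_le => u _ /asboolP/primitiveP prim.
  by apply/allP => p; rewrite mem_primes_upto => /andP[pp _]; exact: prim.
pose mid u := has (fun p => ~~ @full_rank m d p u)
  [seq p <- index_iota M.+2 n.+1 | prime p].
pose large u := `[< exists p, [/\ prime p, (n < p)%N & ~~ @full_rank m d p u] >].
have midC : box_freq R (b' n) n mid <= C * harmonic M.
  exact: box_freq_middle_primes.
have largeC : box_freq R (b' n) n large <= C' / n%:R.
  apply: box_freq_large_primes => // u r ub rm.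
  by apply: abs_det_corner_lt => //; exact: bK ub.
(* A matrix of full rank modulo all small primes is primitive unless a middle or a large prime
   fails, so a union bound gives the lower estimate. *)
rewrite -addrA -opprD lerBlDr.
apply: le_trans (lerD (lexx _) (lerD midC largeC)).
apply: le_trans (lerD (lexx _) (box_freqU R (b' n) n mid large)).
apply: le_trans (box_freqU R (b' n) n Y _).
apply: box_freq_le => u _ /allP small /=; apply/orP.
have [Yu|nY] := boolP (Y u); [by left|right].
have [p [pp nf]] : exists p, prime p /\ ~~ full_rank p u.
  apply: contrapT => H; move/asboolP: nY; apply; apply/primitiveP => p pp.
  by apply: contra_notT H => nf; exists p.
apply/orP; have [pn|np] := leqP p n; last by right; apply/asboolP; exists p.
left; apply/hasP; exists p => //; rewrite mem_filter pp mem_index_iota ltnS pn andbT /=.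
by rewrite ltnNge; apply: contra nf => pM; apply: small; rewrite mem_primes_upto pp.
Unshelve. all: by end_near. Qed.
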